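(* For every $\alpha\in[0,1)$, the set $\mathcal{L}_{Q^{\mathrm{ES}_\alpha}}$ is a convex cone and the expected shortfall $\varrho_{Q^{\mathrm{ES}_\alpha}}$ is subadditive.
   Context: $(\Omega,\mathcal{F},P)$ is a fixed probability space and $\mathcal{L}^0$ is the set of all real random variables on it. $\lambda$ denotes Lebesgue measure on $\mathcal{B}((0,1))$. For $X\in\mathcal{L}^0$, $F_X(x):=P[\{X\le x\}]$ and $F_X^\leftarrow:(0,1)\to\mathbb{R}$, $F_X^\leftarrow(u):=\inf\{x\in\mathbb{R}\mid F_X(x)\ge u\}$, is the (lower) quantile function. For a probability measure $Q$ on $\mathcal{B}((0,1))$, $\mathcal{L}_Q:=\{X\in\mathcal{L}^0\mid\int_{(0,1)}(F_X^\leftarrow(u))^+\,dQ(u)<\infty\}$, and the quantile risk measure $\varrho_Q:\mathcal{L}_Q\to[-\infty,\infty)$ is $\varrho_Q[X]:=\int_{(0,1)}F_X^\leftarrow(u)\,dQ(u)$. For $\alpha\in[0,1)$, $Q^{\mathrm{ES}_\alpha}$ is the probability measure on $\mathcal{B}((0,1))$ with density $u\mapsto\frac{1}{1-\alpha}\chi_{(\alpha,1)}(u)$ with respect to $\lambda$ (equivalently, with distribution function $D^{\mathrm{ES}_\alpha}(u)=\frac{u-\alpha}{1-\alpha}\chi_{[\alpha,1]}(u)$), where $\chi_B$ denotes the indicator function of $B$; $\varrho_{Q^{\mathrm{ES}_\alpha}}$ is called expected shortfall at level $\alpha$. $\varrho_Q$ is called subadditive if $\varrho_Q[X+Y]\le\varrho_Q[X]+\varrho_Q[Y]$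 holds for all $X,Y\in\mathcal{L}_Q$ such that $X+Y\in\mathcal{L}_Q$. A set $\mathcal{C}\subseteq\mathcal{L}^0$ is a convex cone if $X+Y\in\mathcal{C}$ and $aX\in\mathcal{C}$ for all $X,Y\in\mathcal{C}$ and all real $a\ge0$. *)

(* Defs.v *)
From HB Require Import structures.
From mathcomp Require Import all_boot all_order all_algebra.
From mathcomp Require Import all_classical all_reals all_analysis.
From mathcomp Require Import measurable_realfun.

Set Implicit Arguments.
Unset Strict Implicit.
Unset Printing Implicit Defensive.
Import Order.TTheory GRing.Theory Num.Theory.
Import numFieldNormedType.Exports.
Local Open Scope classical_set_scope.
Local Open Scope ring_scope.

(* A probability measure on B((0,1)), encoded as a Borel probability measure on
   the real line carried by ]0, 1[. *)
Structure unit_probability (R : realType) := UnitProbability {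
  up_prob :> probability R R ;
  up_carried : up_prob `]0, 1[%classic = 1%E }.

Section quantile_risk_measure.
Context d (T : measurableType d) (R : realType) (P : probability T R).
Implicit Types (X Y : {RV P >-> R}) (Q : unit_probability R).

(* Only meaningful for 0 < u < 1, where the set is nonempty and bounded from
   below: elsewhere [inf] may return its default value 0. *)
Definition lower_quantile X (u : R) : R := inf [set x | (u%:E <= cdf X x)%E].

Definition quantile_domain Q : set {RV P >-> R} :=
  [set X | (\int[Q]_(u in `]0%R, 1%R[) ((lower_quantile X)^\+ u)%:E < +oo)%E].

Definition quantile_risk Q X : \bar R :=
  (\int[Q]_(u in `]0%R, 1%R[) (lower_quantile X u)%:E)%E.

Definition convex_cone (C : set {RV P >-> R}) : Prop :=
  (forall X Y, C X -> C Y -> C (X \+ Y : {RV P >-> R})) /\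
  (forall (a : R) X, 0 <= a -> C X -> C (a \o* X : {RV P >-> R})).

(* On [quantile_domain Q] the value [+oo] is excluded, so that the right-hand
   side never is of the form [+oo - oo]. *)
Definition risk_subadditive Q : Prop := forall X Y,
  quantile_domain Q X -> quantile_domain Q Y ->
  quantile_domain Q (X \+ Y : {RV P >-> R}) ->
  (quantile_risk Q (X \+ Y : {RV P >-> R})%R
     <= quantile_risk Q X + quantile_risk Q Y)%E.

End quantile_risk_measure.

Section expected_shortfall_probability.
Context (R : realType) (alpha : R).
Local Notation lambda := (@lebesgue_measure R).

Definition ES_density (u : R) : R := (1 - alpha)^-1 * \1_(`]alpha, 1[) u.

Definition ES_measure (alpha01 : 0 <= alpha < 1) (A : set R) : \bar R :=
  (\int[lambda]_(u in A) (ES_density u)%:E)%E.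

Hypothesis alpha01 : 0 <= alpha < 1.

Let alpha_lt1 : alpha < 1. Proof. by case/andP: alpha01. Qed.

Lemma ES_density_ge0 u : 0 <= ES_density u.
Proof. by rewrite mulr_ge0// invr_ge0 subr_ge0 ltW. Qed.

Lemma measurable_ES_density : measurable_fun setT ES_density.
Proof. by apply: measurable_funM => //; exact: measurable_indic. Qed.

Let ES0 : ES_measure alpha01 set0 = 0%E.
Proof. by rewrite /ES_measure integral_set0. Qed.

Let ES_ge0 A : (0 <= ES_measure alpha01 A)%E.
Proof. by apply: integral_ge0 => u _; rewrite lee_fin ES_density_ge0. Qed.

Let ES_sigma_additive : semi_sigma_additive (ES_measure alpha01).
Proof.
move=> /= F mF tF mUF; rewrite /ES_measure; apply: cvg_toP.
  apply: ereal_nondecreasing_is_cvgn => m n mn.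
  apply: lee_sum_nneg_natr => // k _ _.
  by apply: integral_ge0 => /= x Fkx; rewrite lee_fin ES_density_ge0.
rewrite ge0_integral_bigcup//=.
- apply: measurable_funTS; apply: measurableT_comp => //.
  exact: measurable_ES_density.
- by move=> x _; rewrite lee_fin ES_density_ge0.
Qed.

HB.instance Definition _ := isMeasure.Build _ _ _ (ES_measure alpha01)
  ES0 ES_ge0 ES_sigma_additive.

Let ES_eq1 A : measurable A -> `]alpha, 1[ `<=` A -> ES_measure alpha01 A = 1%E.
Proof.
move=> mA sA; rewrite /ES_measure /ES_density.
under eq_integral do rewrite EFinM.
rewrite ge0_integralZl_EFin//; last 2 first.
- by apply/measurable_EFinP; exact: measurable_indic.
- by rewrite invr_ge0 subr_ge0 ltW.
rewrite integral_indic// setIidl//= lebesgue_measure_itv/= lte_fin alpha_lt1.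
by rewrite -EFinD -EFinM mulVf// subr_eq0 gt_eqF.
Qed.

Let ES_setT : ES_measure alpha01 [set: _] = 1%E.
Proof. exact: ES_eq1. Qed.

HB.instance Definition _ := @Measure_isProbability.Build _ _ R
  (ES_measure alpha01) ES_setT.

Lemma ES_measure_carried : ES_measure alpha01 `]0, 1[%classic = 1%E.
Proof.
apply: ES_eq1 => // u /=; rewrite !in_itv/= => /andP[au ->].
by case/andP: alpha01 => a0 _; rewrite (le_lt_trans a0 au).
Qed.

Definition ES_probability : unit_probability R :=
  UnitProbability (up_prob := ES_measure alpha01) ES_measure_carried.

End expected_shortfall_probability.

(* Main.v *)
Require Import Defs.
From HB Require Import structures.
From mathcomp Require Import all_boot all_order all_algebra.
From mathcomp Require Import all_classical all_reals all_analysis.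
From mathcomp Require Import measurable_realfun.
From mathcomp Require Import ring lra.

Import Order.TTheory GRing.Theory Num.Theory.
Import numFieldNormedType.Exports.
Local Open Scope classical_set_scope.
Local Open Scope ring_scope.

(* Under Lebesgue measure on ]0, 1[ the quantile function q of X has the law of
   X, so E(X - c)^+ is the integral of (q - c)^+ over ]0, 1[.  Hence the domain
   of ES consists of the X with E X^+ finite and, for alpha > 0,
     ES(X) = min_c (c + E(X - c)^+ / (1 - alpha)),
   with the minimum attained at c = q(alpha) (Rockafellar-Uryasev).  As
   (X + Y - c - c')^+ <= (X - c)^+ + (Y - c')^+, subadditivity follows by taking
   c = q_X(alpha) and c' = q_Y(alpha).  For alpha = 0, ES is the expectation,
   which may be -oo. *)

(** * Integrals with values in the extended reals *)

Lemma integral_funrposneg d (T : measurableType d) (R : realType)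
    (mu : {measure set T -> \bar R}) (D : set T) (f : T -> R) :
  (\int[mu]_(x in D) (f x)%:E =
    \int[mu]_(x in D) (f^\+ x)%:E - \int[mu]_(x in D) (f^\- x)%:E)%E.
Proof. by have := integralE mu D (EFin \o f); rewrite funerpos funerneg. Qed.

(* When a negative part has infinite integral, both sides are -oo: the identity
   (f + g)^+ + f^- + g^- = (f + g)^- + f^+ + g^+ covers that case too. *)
Lemma integral_funrD_le d (T : measurableType d) (R : realType)
    (mu : {measure set T -> \bar R}) (f g : T -> R) :
  measurable_fun setT f -> measurable_fun setT g ->
  (\int[mu]_x (f^\+ x)%:E < +oo)%E -> (\int[mu]_x (g^\+ x)%:E < +oo)%E ->
  (\int[mu]_x ((f \+ g) x)%:E <= \int[mu]_x (f x)%:E + \int[mu]_x (g x)%:E)%E.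
Proof.
move=> mf mg.
have mpos (h : T -> R) : measurable_fun setT h ->
    measurable_fun setT (EFin \o h^\+).
  by move=> mh; apply/measurable_EFinP; exact: measurable_funrpos.
have mneg (h : T -> R) : measurable_fun setT h ->
    measurable_fun setT (EFin \o h^\-).
  by move=> mh; apply/measurable_EFinP; exact: measurable_funrneg.
have mfg : measurable_fun setT (f \+ g) by exact: measurable_funD.
have pos0 (h : T -> R) : (0 <= \int[mu]_x (h^\+ x)%:E)%E.
  by apply: integral_ge0 => x _; rewrite lee_fin funrpos_ge0.
have neg0 (h : T -> R) : (0 <= \int[mu]_x (h^\- x)%:E)%E.
  by apply: integral_ge0 => x _; rewrite lee_fin funrneg_ge0.
have : (\int[mu]_x ((f \+ g)^\+ x)%:E
    + (\int[mu]_x (f^\- x)%:E + \int[mu]_x (g^\- x)%:E)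
  = \int[mu]_x ((f \+ g)^\- x)%:E
    + (\int[mu]_x (f^\+ x)%:E + \int[mu]_x (g^\+ x)%:E))%E.
  rewrite -!ge0_integralD//=; try solve [exact: mpos|exact: mneg
    | by move=> x _; rewrite ?adde_ge0 ?lee_fin ?funrpos_ge0 ?funrneg_ge0
    | by apply: emeasurable_funD; first [exact: mpos|exact: mneg]].
  apply: eq_integral => x _; rewrite -!EFinD; congr _%:E.
  have posE (h : T -> R) : h^\+ x = h x + h^\- x.
    have e : h^\+ x - h^\- x = h x.
      exact: (congr1 (fun k => k x) (funrposBneg h)).
    by rewrite -e subrK.
  by rewrite !posE /=; ring.
rewrite (integral_funrposneg _ _ _ mu setT (f \+ g)).
rewrite (integral_funrposneg _ _ _ mu setT f).
rewrite (integral_funrposneg _ _ _ mu setT g).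
move: (pos0 (f \+ g)) (neg0 (f \+ g)) (pos0 f) (neg0 f) (pos0 g) (neg0 g).
set a1 := (\int[mu]_x ((f \+ g)^\+ x)%:E)%E.
set a2 := (\int[mu]_x ((f \+ g)^\- x)%:E)%E.
move: a1 a2 (\int[mu]_x (f^\+ x)%:E)%E (\int[mu]_x (f^\- x)%:E)%E
  (\int[mu]_x (g^\+ x)%:E)%E (\int[mu]_x (g^\- x)%:E)%E.
move=> a1 a2 b1 b2 c1 c2 a10 a20 b10 b20 c10 c20 + b1y c1y.
have -> : b1 = (fine b1)%:E by rewrite fineK// ge0_fin_numE.
have -> : c1 = (fine c1)%:E by rewrite fineK// ge0_fin_numE.
case: a2 a20 => [a2||]// _ e; last by rewrite addeNy leNye.
(* The right-hand side of [e] is now finite, which forces [a1], [b2] and [c2] to be finite; linear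
   arithmetic over the reals remains. *)
move: e; case: b2 b20 => [b2||]//; case: c2 c20 => [c2||]//;
  case: a1 a10 => [a1||]// _ _ _ [e].
by rewrite -!EFinB -EFinD lee_fin; lra.
Qed.

(** The restricted measure does not charge the complement of [E], and it agrees with [mu] on
    measurable subsets of [E]. *)
Lemma ge0_integral_mrestr d (T : measurableType d) (R : realType)
    (mu : {measure set T -> \bar R}) (D E : set T) (mE : measurable E)
    (f : T -> \bar R) :
  measurable D -> measurable_fun D f -> (forall x, D x -> 0 <= f x)%E ->
  (\int[mrestr mu mE]_(x in D) f x = \int[mu]_(x in D `&` E) f x)%E.
Proof.
move=> mD mf f0; rewrite [LHS](@ge0_negligible_integral _ _ _ _ _ (~` E))//.
- rewrite setDE setCK; apply: (eq_measure_integral mu) => A mA AE /=.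
  by rewrite /mrestr setIidl// => x /AE[].
- exact: measurableC.
- by rewrite /= /mrestr setICl measure0.
Qed.

(** * The lower quantile function and its law *)

Section quantile_theory.
Context d (T : measurableType d) (R : realType) (P : probability T R).
Implicit Types (X : {RV P >-> R}) (u x : R).
Local Notation lambda := (@lebesgue_measure R).

(** The limit 1 of the distribution function at +oo and [u < 1] give a point of the set; the limit 0
    at -oo and [0 < u] give a lower bound. *)
Lemma lower_quantile_has_inf X u : 0 < u < 1 ->
  has_inf [set x | (u%:E <= cdf X x)%E].
Proof.
move=> /andP[u0 u1]; split.
- have : \forall x \near +oo, (u%:E < cdf X x)%E.
    apply: (@cvg_cdfy1 _ _ _ _ X [set z | (u%:E < z)%E]).
    by apply: open_ereal_gt'; rewrite lte_fin.
  (* The neighbourhood of +oo is the open ray above [M], whence the witness [M + 1]. *)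
  move=> [M [_ /(_ (M + 1))]]; rewrite ltrDl ltr01 => /(_ isT)/ltW.
  by exists (M + 1).
- have : \forall x \near -oo, (cdf X x < u%:E)%E.
    apply: (@cvg_cdfNy0 _ _ _ _ X [set z | (z < u%:E)%E]).
    by apply: open_ereal_lt'; rewrite lte_fin.
  move=> [M [_ FM]]; exists M => y /= uy; rewrite leNgt; apply/negP => /FM.
  by rewrite ltNge uy.
Qed.

(* Left to right, this is the right-continuity of the distribution function. *)
Lemma lower_quantile_le X u x : 0 < u < 1 ->
  (lower_quantile X u <= x) = (u%:E <= cdf X x)%E.
Proof.
move=> u01; have [S0 Slb] := lower_quantile_has_inf X u u01.
apply/idP/idP => [qx|]; last exact: ge_inf.
apply: (@le_trans _ _ (cdf X (lower_quantile X u))); last first.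
  exact: cdf_nondecreasing.
apply: (cvge_ge _ (@cdf_right_continuous _ _ _ _ X (lower_quantile X u))).
near=> y; have qy : 0 < y - lower_quantile X u.
  by rewrite subr_gt0; near: y; exact: nbhs_right_gt.
(* Since [y] exceeds the infimum, some [z] of the set lies below [y], and monotonicity carries the
   bound from [z] to [y]. *)
have [z /= Sz] := inf_adherent qy (conj S0 Slb).
rewrite addrC subrK => /ltW zy; exact: le_trans Sz (cdf_nondecreasing X zy).
Unshelve. all: by end_near. Qed.

Lemma lower_quantile_le_homo X u v : 0 < u < 1 -> 0 < v < 1 -> u <= v ->
  lower_quantile X u <= lower_quantile X v.
Proof.
move=> u01 v01 uv; rewrite lower_quantile_le//.
by rewrite (@le_trans _ _ v%:E) ?lee_fin// -lower_quantile_le.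
Qed.

(** Negation of the equivalence [lower_quantile_le]. It gives both the measurability of the quantile
    function and its law, as the interval on the right has length [1 - cdf X x]. *)
Lemma lower_quantile_gt_preimage X x :
  `]0, 1[ `&` lower_quantile X @^-1` `]x, +oo[ = `]fine (cdf X x), 1[%classic.
Proof.
have F0 : 0 <= fine (cdf X x) by rewrite fine_ge0.
have ltE u : 0 < u < 1 -> (x < lower_quantile X u) = (fine (cdf X x) < u).
  move=> u01; rewrite ltNge lower_quantile_le// -ltNge.
  by rewrite -[cdf X x]fineK ?fin_num_measure.
apply/seteqP; split => u /=; rewrite !in_itv/= ?andbT.
- by move=> [u01]; rewrite ltE//; case/andP: u01 => _ -> ->.
- move=> /andP[Fu u1]; have u01 : 0 < u < 1 by rewrite (le_lt_trans F0).
  by rewrite ltE.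
Qed.

Lemma measurable_lower_quantile X :
  measurable_fun (`]0, 1[ : set R) (lower_quantile X).
Proof.
apply: (measurability (@RGenOInfty.G R)) => [|/= _ [_] [r ->] <-].
  exact: RGenOInfty.measurableE.
by rewrite lower_quantile_gt_preimage.
Qed.

(* Patching by 0 outside `]0, 1[ makes the quantile function measurable on R. *)
Let q X := lower_quantile X \_ `]0, 1[.

Let mq X : measurable_fun [set: measurableTypeR R] (q X).
Proof.
apply/(measurable_restrictT _ _).1 => //; exact: measurable_lower_quantile.
Qed.

Let lambda01 : {measure set _ -> \bar R} :=
  mrestr lambda (measurable_itv `]0%R, 1%R[).

(** The open upper rays generate the Borel sets and are stable under intersection, so it suffices to
    compare the measures on them: both give [1 - cdf X x] to []x, +oo[]. *)
Let pushforward_lower_quantile X A : measurable A ->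
  pushforward lambda01 (q X) A = distribution P X A.
Proof.
have F0 x : 0 <= fine (cdf X x) by rewrite fine_ge0.
have F1 x : fine (cdf X x) <= 1.
  by rewrite -lee_fin fineK ?fin_num_measure// cdf_le1.
have ray x : pushforward lambda01 (q X) `]x, +oo[ = distribution P X `]x, +oo[.
  transitivity (lambda `]fine (cdf X x), 1[%classic).
    rewrite -lower_quantile_gt_preimage /pushforward /= /mrestr setIC.
    by congr (lambda _); apply/seteqP; split => u /= [u01];
      rewrite /q patchE mem_set.
  rewrite lebesgue_measure_itv/= lte_fin.
  transitivity (1 - (fine (cdf X x))%:E)%E.
    (* If the distribution function is already 1 at [x], the interval is empty and the length
       formula falls into its default case 0. *)
    by move: (F1 x); rewrite le_eqVlt => /orP[/eqP ->|->//]; rewrite ltxx subee.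
  rewrite fineK ?fin_num_measure// -(cdf_ccdf_1 X x) addeAC subee ?add0e//.
  by rewrite fin_num_measure.
have ray_lty x : (pushforward lambda01 (q X) `]x, +oo[ < +oo)%E.
  by rewrite ray (le_lt_trans (probability_le1 _ _)) ?ltry.
apply: (@measure_unique _ _ _ (@RGenOInfty.G R)
  (fun n : nat => `](- n%:R), +oo[%classic) _ _ _ _
  (pushforward lambda01 (q X)) (distribution P X)) => //.
- exact: RGenOInfty.measurableE.
- move=> _ _ [x ->] [y ->]; exists (Num.max x y).
  by apply/seteqP; split => z /=; rewrite !in_itv/= !andbT gt_max => /andP.
- by move=> n; exists (- n%:R).
(* The rays starting at the negated naturals cover the line: this [n] satisfies [- n%:R < x]. *)
- rewrite -subTset => x _; exists (Num.truncn (- x)).+1 => //=.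
  by rewrite in_itv/= andbT ltrNl truncnS_gt.
- by move=> _ [x ->]; exact: ray.
- by move=> n; exact: ray_lty.
Qed.

(** Both sides are the integral of [g] against the law of [X], by two changes of variables. *)
Lemma ge0_integral_lower_quantile X (g : R -> \bar R) :
  measurable_fun setT g -> (forall x, 0 <= g x)%E ->
  (\int[lambda]_(u in `]0%R, 1%R[) g (lower_quantile X u)
    = \int[P]_x g (X x))%E.
Proof.
move=> mg g0; rewrite -[RHS](@ge0_integral_distribution _ _ _ _ _ _ X g)//.
transitivity (\int[lambda01]_(u in q X @^-1` setT) (g \o q X) u)%E.
  rewrite preimage_setT ge0_integral_mrestr//.
  - by rewrite setTI; apply: eq_integral => u u01; rewrite /= /q patchE u01.
  - exact: (measurableT_comp mg (mq X)).
  - by move=> u _; exact: g0.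
rewrite -ge0_integral_pushforward//.
by apply: eq_measure_integral => A mA _; exact: pushforward_lower_quantile.
Qed.

(** The positive and negative parts are transported separately, so infinite integrals are covered.
    This identifies expected shortfall at level 0 with the expectation. *)
Lemma integral_lower_quantile X :
  (\int[lambda]_(u in `]0%R, 1%R[) (lower_quantile X u)%:E
    = \int[P]_x (X x)%:E)%E.
Proof.
rewrite integral_funrposneg [RHS]integral_funrposneg; congr (_ - _)%E.
- apply: (ge0_integral_lower_quantile X
    (fun x => (Num.max x 0)%:E)) => [|x].
    by apply/measurable_EFinP; exact: measurable_maxr.
  by rewrite lee_fin le_max lexx orbT.
- apply: (ge0_integral_lower_quantile X
    (fun x => (Num.max (- x) 0)%:E)) => [|x].
    by apply/measurable_EFinP/measurable_maxr => //; exact: measurable_funN.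
  by rewrite lee_fin le_max lexx orbT.
Qed.

End quantile_theory.

(** * Expected shortfall as a tail integral *)

Section expected_shortfall.
Context d (T : measurableType d) (R : realType) (P : probability T R).
Context (alpha : R) (alpha01 : 0 <= alpha < 1).
Implicit Types (X Y : {RV P >-> R}) (c : R).
Local Notation lambda := (@lebesgue_measure R).
Local Notation ES := (ES_probability alpha01).

Let alpha_ge0 : 0 <= alpha. Proof. by case/andP: alpha01. Qed.

Let alpha_lt1 : alpha < 1. Proof. by case/andP: alpha01. Qed.

Let inv_gt0 : 0 < (1 - alpha)^-1. Proof. by rewrite invr_gt0 subr_gt0. Qed.

Let sub_tail : `]alpha, 1[%classic `<=` `]0, 1[%classic.
Proof. by apply: subset_itvr; rewrite bnd_simp. Qed.

Let tail01 u : `]alpha, 1[%classic u -> 0 < u < 1.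
Proof. by move=> /sub_tail; rewrite /= in_itv. Qed.

(** The density is constant on the tail and zero elsewhere, so the measure is a rescaled restriction
    of Lebesgue measure. *)
Lemma ge0_integral_ES (f : R -> \bar R) :
  measurable_fun (`]0, 1[ : set R) f -> (forall u, 0 <= f u)%E ->
  (\int[ES]_(u in `]0%R, 1%R[) f u
    = ((1 - alpha)^-1)%:E * \int[lambda]_(u in `]alpha, 1%R[) f u)%E.
Proof.
move=> mf f0; pose k := NngNum (ltW inv_gt0).
pose m : {measure set _ -> \bar R} :=
  mscale k (mrestr lambda (measurable_itv `]alpha, 1[)).
(* The identity map links two presentations of the Borel line: [m] lives on [measurableTypeR R] and
   is pushed forward to [R], where [ES] lives. *)
pose i (u : measurableTypeR R) : R := u.
have mi : measurable_fun setT i by exact: measurable_id.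
rewrite -(setIidr sub_tail) -ge0_integral_mrestr//.
rewrite -[(1 - alpha)^-1]/(k%:num) -ge0_integral_mscale//.
apply: etrans; last exact: (ge0_integral_pushforward mi m
  (measurable_itv `]0, 1[) mf (fun u _ => f0 u)).
apply: eq_measure_integral => A mA _; rewrite /= /ES_measure /mscale /mrestr/=.
under eq_integral do rewrite EFinM.
rewrite ge0_integralZl_EFin//; last 2 first.
- by apply/measurable_EFinP; exact: measurable_indic.
- exact: ltW.
by rewrite integral_indic// setIC.
Qed.

Let pos0 (x : R) : (0 <= (Num.max x 0)%:E)%E.
Proof. by rewrite lee_fin le_max lexx orbT. Qed.

Let mquant X (g : R -> R) : measurable_fun setT g ->
  measurable_fun (`]0, 1[ : set R) (fun u => (g (lower_quantile X u))%:E).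
Proof.
move=> mg; apply/measurable_EFinP/(measurableT_comp mg).
exact: measurable_lower_quantile.
Qed.

Let mquant_tail X (g : R -> R) : measurable_fun setT g ->
  measurable_fun (`]alpha, 1[ : set R) (fun u => (g (lower_quantile X u))%:E).
Proof. by move=> mg; apply: measurable_funS (mquant X g mg). Qed.

Let mpos : measurable_fun setT (fun x : R => Num.max x 0).
Proof. exact: measurable_maxr. Qed.

Let mneg : measurable_fun setT (fun x : R => Num.max (- x) 0).
Proof. by apply: measurable_maxr => //; exact: measurable_funN. Qed.

Let mexcess c : measurable_fun setT (fun x : R => Num.max (x - c) 0).
Proof. by apply: measurable_maxr => //; exact: measurable_funB. Qed.

Lemma integral_tail_excess_le X c :
  (\int[lambda]_(u in `]alpha, 1%R[) (Num.max (lower_quantile X u - c) 0)%:E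
    <= \int[P]_x (Num.max (X x - c) 0)%:E)%E.
Proof.
rewrite -(ge0_integral_lower_quantile _ _ _ _ X
  (fun x => (Num.max (x - c) 0)%:E)).
- by apply: ge0_subset_integral => //; exact: (mquant X _ (mexcess c)).
- exact/measurable_EFinP.
- by move=> x; exact: pos0.
Qed.

Lemma integral_tail_pos_le X :
  (\int[lambda]_(u in `]alpha, 1%R[) ((lower_quantile X)^\+ u)%:E
    <= \int[P]_x (X^\+ x)%:E)%E.
Proof.
have := integral_tail_excess_le X 0.
under eq_integral do rewrite subr0.
by under [leRHS]eq_integral do rewrite subr0.
Qed.

Let head_tail : `]0, 1[%classic = `]0, alpha] `|` `]alpha, 1[ :> set R.
Proof. by apply: itv_bndbnd_setU; rewrite bnd_simp. Qed.

(** The excess over [c] vanishes on the head []0, alpha]], so the expectation only sees the tail. *)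
Lemma integral_excessE X c :
  (forall u, 0 < u <= alpha -> lower_quantile X u <= c) ->
  (\int[P]_x (Num.max (X x - c) 0)%:E
    = \int[lambda]_(u in `]alpha, 1%R[)
        (Num.max (lower_quantile X u - c) 0)%:E)%E.
Proof.
move=> qc.
rewrite -(ge0_integral_lower_quantile _ _ _ _ X
  (fun x => (Num.max (x - c) 0)%:E)).
- rewrite head_tail ge0_integral_setU//.
  + rewrite integral0_eq ?add0e// => u; rewrite /= in_itv/= => /qc qu.
    by rewrite max_r// subr_le0.
  + by rewrite -head_tail; exact: (mquant X _ (mexcess c)).
  + apply/disj_setPS => u /=; rewrite !in_itv/= => -[/andP[_ ua] /andP[au _]].
    by move: ua; rewrite leNgt au.
- exact/measurable_EFinP.
- by move=> x; exact: pos0.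
Qed.

(** If the tail integral is finite, so is the mean of [X^\+]: it is at most [c] plus the mean excess
    over [c], and for [c] above the quantiles of the head that excess is an integral over the
    tail. *)
Lemma ES_quantile_domainE X : quantile_domain ES X <->
  (\int[P]_x (X^\+ x)%:E < +oo)%E.
Proof.
rewrite /quantile_domain /= ge0_integral_ES; first last.
- by move=> u; exact: pos0.
- exact: (mquant X _ mpos).
split => [tail_lty|mean_lty]; last first.
  rewrite lte_mul_pinfty ?lee_fin ?ltW//.
  exact: le_lt_trans (integral_tail_pos_le X) mean_lty.
(* For alpha = 0, [lower_quantile X alpha] is a junk value, but then no
   condition on [c] is needed, since `]0, alpha] is empty. *)
pose c := Num.max (lower_quantile X alpha) 0.
have c0 : 0 <= c by rewrite le_max lexx orbT.
apply: (@le_lt_trans _ _ (\int[P]_x ((Num.max (X x - c) 0)%:E + c%:E))%E).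
  apply: ge0_le_integral => //=.
  - by move=> x _; exact: pos0.
  - by apply/measurable_EFinP; exact: measurable_funrpos.
  - apply: emeasurable_funD => //.
    exact/measurable_EFinP/(measurableT_comp (mexcess c)).
  - move=> x _; rewrite -EFinD lee_fin /funrpos ge_max -lerBlDr le_max lexx/=.
    by rewrite addr_ge0// le_max lexx orbT.
rewrite ge0_integralD//=; last first.
  exact/measurable_EFinP/(measurableT_comp (mexcess c)).
have -> : (\int[P]__ c%:E = c%:E)%E.
  rewrite (integral_cst P measurableT c%:E) -[RHS]mule1.
  by congr (_ * _)%E; exact: probability_setT.
rewrite lte_add_pinfty ?ltry//.
rewrite integral_excessE; last first.
  move=> u /andP[u0 ua]; rewrite le_max.
  rewrite lower_quantile_le_homo ?u0 ?(le_lt_trans ua)//.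
  by rewrite (lt_le_trans u0).
apply: (@le_lt_trans _ _ (\int[lambda]_(u in `]alpha, 1%R[)
    ((lower_quantile X)^\+ u)%:E)%E).
  apply: ge0_le_integral => //.
  - exact: (mquant_tail X _ (mexcess c)).
  - exact: (mquant_tail X _ mpos).
  - move=> u _; rewrite lee_fin ge_max !le_max lexx orbT andbT.
    by rewrite lerBlDr lerDl c0.
by move: tail_lty; rewrite -lte_pdivlMl// invrK gt0_muley// lte_fin subr_gt0.
Qed.

Let tail_posy X : quantile_domain ES X ->
  (\int[lambda]_(u in `]alpha, 1%R[) ((lower_quantile X)^\+ u)%:E < +oo)%E.
Proof.
by move=> /ES_quantile_domainE; exact/le_lt_trans/integral_tail_pos_le.
Qed.

(** The positive part of the tail integral is finite on the domain, so the factor distributes over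
    the difference of the two parts even if the negative one is infinite. *)
Lemma ES_quantile_riskE X : quantile_domain ES X ->
  (quantile_risk ES X
    = ((1 - alpha)^-1)%:E
      * \int[lambda]_(u in `]alpha, 1%R[) (lower_quantile X u)%:E)%E.
Proof.
move=> /tail_posy tail_lty.
rewrite /quantile_risk integral_funrposneg.
rewrite (integral_funrposneg _ _ _ lambda) muleBr//; last first.
  apply: fin_num_adde_defr; rewrite ge0_fin_numE//.
  by apply: integral_ge0 => u _; rewrite lee_fin funrpos_ge0.
rewrite !ge0_integral_ES//.
- exact: (mquant X _ mneg).
- by move=> u; rewrite lee_fin funrneg_ge0.
- exact: (mquant X _ mpos).
- by move=> u; rewrite lee_fin funrpos_ge0.
Qed.

(** For [0 < alpha] the quantile at [alpha] bounds the tail from below, so the absolute value is at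
    most the positive part plus a constant. *)
Lemma integrable_tail_lower_quantile X : 0 < alpha -> quantile_domain ES X ->
  lambda.-integrable `]alpha, 1[ (EFin \o lower_quantile X).
Proof.
move=> alpha0 /tail_posy tail_lty; pose c := `|lower_quantile X alpha|.
have mq : measurable_fun (`]alpha, 1[ : set R) (EFin \o lower_quantile X).
  exact: (mquant_tail X id).
apply/integrableP; split => //.
apply: (@le_lt_trans _ _ (\int[lambda]_(u in `]alpha, 1%R[)
    (((lower_quantile X)^\+ u)%:E + c%:E))%E).
  apply: ge0_le_integral => //.
  - exact: measurableT_comp.
  - by apply: emeasurable_funD => //; exact: (mquant_tail X _ mpos).
  - move=> u au; rewrite -EFinD lee_fin /funrpos.
    have : lower_quantile X alpha <= lower_quantile X u.
      apply: lower_quantile_le_homo; rewrite ?alpha0 ?tail01//.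
      by move: au; rewrite /= in_itv/= => /andP[/ltW].
    move: (lower_quantile X u) (lower_quantile X alpha) @c => x y c yx.
    rewrite /c; have [x0|x0] := leP 0 x.
      by rewrite ger0_norm// lerDl.
    by rewrite add0r !ltr0_norm ?lerN2// (le_lt_trans yx).
rewrite ge0_integralD//; last 3 first.
- by move=> u _; rewrite lee_fin funrpos_ge0.
- exact: (mquant_tail X _ mpos).
- by move=> u _; rewrite lee_fin /c.
rewrite lte_add_pinfty// (integral_cst lambda (measurable_itv _) c%:E).
by rewrite /= lebesgue_measure_itv/= lte_fin alpha_lt1 -EFinB -EFinM ltry.
Qed.

(** * The Rockafellar-Uryasev formula for positive levels *)

Let integrable_tail_cst c :
  lambda.-integrable (`]alpha, 1[ : set R) (EFin \o cst c).
Proof.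
apply/integrableP; split; first exact/measurable_EFinP.
rewrite (integral_cst lambda (measurable_itv _) `|c%:E|%E) /=.
by rewrite lebesgue_measure_itv/= lte_fin alpha_lt1 -EFinB -EFinM ltry.
Qed.

Let tail_shift X c : 0 < alpha -> quantile_domain ES X ->
  (\int[lambda]_(u in `]alpha, 1%R[) (lower_quantile X u)%:E
    = ((1 - alpha) * c)%:E
      + \int[lambda]_(u in `]alpha, 1%R[) (lower_quantile X u - c)%:E)%E.
Proof.
move=> alpha0 domX; have iq := integrable_tail_lower_quantile X alpha0 domX.
have ic := integrable_tail_cst c.
under [X in (_ + X)%E]eq_integral do rewrite EFinB.
rewrite integralB//.
rewrite (integral_cst lambda (measurable_itv _) c%:E) /=.
rewrite lebesgue_measure_itv/= lte_fin alpha_lt1 -EFinB -EFinM.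
by rewrite addeCA -EFinB mulrC subrr adde0.
Qed.

(** Here [c] is arbitrary: the tail integral of the shifted quantile function is bounded by that of
    its positive part, hence by the mean excess. Subadditivity uses it at a sum of two quantiles. *)
Lemma tail_integral_le X c : 0 < alpha -> quantile_domain ES X ->
  (\int[lambda]_(u in `]alpha, 1%R[) (lower_quantile X u)%:E
    <= ((1 - alpha) * c)%:E + \int[P]_x (Num.max (X x - c) 0)%:E)%E.
Proof.
move=> alpha0 domX; rewrite (tail_shift X c)// leeD2l//.
apply: le_trans (integral_tail_excess_le X c).
rewrite integral_funrposneg geeDl// oppe_le0.
by apply: integral_ge0 => u _; rewrite lee_fin funrneg_ge0.
Qed.

(* The minimum over [c] in [tail_integral_le] is attained at the quantile. *)
Lemma tail_integralE X (c := lower_quantile X alpha) :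
  0 < alpha -> quantile_domain ES X ->
  (\int[lambda]_(u in `]alpha, 1%R[) (lower_quantile X u)%:E
    = ((1 - alpha) * c)%:E + \int[P]_x (Num.max (X x - c) 0)%:E)%E.
Proof.
move=> alpha0 domX; rewrite (tail_shift X c)//; congr (_ + _)%E.
rewrite integral_excessE => [|u /andP[u0 ua]]; last first.
  apply: lower_quantile_le_homo; rewrite // ?u0 ?alpha0 ?alpha_lt1//=.
  exact: le_lt_trans ua _.
(* On the tail the quantile function is at least [c], so taking the positive part changes
   nothing. *)
apply: eq_integral => u; rewrite inE => au; rewrite max_l// subr_ge0.
apply: lower_quantile_le_homo; rewrite ?alpha0 ?tail01//.
by move: au; rewrite /= in_itv/= => /andP[/ltW].
Qed.

(** * Convex cone and subadditivity *)

Lemma ES_convex_cone : convex_cone (quantile_domain (P := P) ES).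
Proof.
(* In terms of expectations, closure follows from [(X + Y)^+ <= X^+ + Y^+] and, for [0 <= a], from
   [(a X)^+ = a X^+]. *)
split=> [X Y domX domY|a X a0 domX]; apply/ES_quantile_domainE.
- move/ES_quantile_domainE : domX => domX.
  move/ES_quantile_domainE : domY => domY.
  apply: le_lt_trans (lte_add_pinfty domX domY).
  rewrite -ge0_integralD//=; last 4 first.
  + by move=> x _; rewrite lee_fin funrpos_ge0.
  + by apply/measurable_EFinP; exact: measurable_funrpos.
  + by move=> x _; rewrite lee_fin funrpos_ge0.
  + by apply/measurable_EFinP; exact: measurable_funrpos.
  apply: ge0_le_integral => //=.
  + by move=> x _; rewrite lee_fin funrpos_ge0.
  + apply/measurable_EFinP; apply: measurable_funrpos.
    exact: measurable_funD.
  + apply: emeasurable_funD; apply/measurable_EFinP;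
      exact: measurable_funrpos.
  + move=> x _; rewrite -EFinD lee_fin /funrpos /=.
    by rewrite ge_max lerD ?le_max ?lexx// addr_ge0// le_max lexx orbT.
- move/ES_quantile_domainE : domX => domX.
  have -> : (a \o* X)^\+ = (fun x => a * X^\+ x).
    apply/funext => x; rewrite /funrpos /= mulrC.
    by rewrite maxr_pMr// mulr0.
  under eq_integral do rewrite EFinM.
  rewrite ge0_integralZl_EFin//=; last 2 first.
  + by move=> x _; rewrite lee_fin funrpos_ge0.
  + by apply/measurable_EFinP; exact: measurable_funrpos.
  by rewrite lte_mul_pinfty.
Qed.

Lemma ES_subadditive : risk_subadditive P ES.
Proof.
move=> X Y domX domY domXY; rewrite !ES_quantile_riskE//.
have [alpha0|alpha_le0] := ltP 0 alpha; last first.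
  have -> : alpha = 0 by apply/eqP; rewrite eq_le alpha_le0.
  rewrite subr0 invr1 !mul1e !integral_lower_quantile.
  by apply: integral_funrD_le => //; exact/ES_quantile_domainE.
(* Factoring out the constant requires a sum that is not of the form +oo - oo; the tail integral of
   [X] is finite. *)
rewrite -muleDr//; last first.
  apply: fin_num_adde_defr; apply: integrable_fin_num => //.
  exact: integrable_tail_lower_quantile.
rewrite lee_pmul2l//.
pose c := lower_quantile X alpha; pose c' := lower_quantile Y alpha.
apply: le_trans (tail_integral_le _ (c + c') alpha0 domXY) _.
rewrite (tail_integralE _ alpha0 domX) (tail_integralE _ alpha0 domY).
(* The constant terms agree on both sides, which leaves a comparison of mean excesses. *)
rewrite addeACA -EFinD -mulrDr leeD2l//.
have mexc (Z : {RV P >-> R}) b :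
    measurable_fun setT (fun x => (Num.max (Z x - b) 0)%:E).
  by apply/measurable_EFinP/(measurableT_comp (mexcess b)).
rewrite -ge0_integralD//.
apply: ge0_le_integral => //=.
- exact: (mexc (X \+ Y : {RV P >-> R})).
- by apply: emeasurable_funD; exact: mexc.
- move=> x _; rewrite -EFinD lee_fin opprD addrACA.
  by rewrite ge_max lerD ?le_max ?lexx// addr_ge0// le_max lexx orbT.
Qed.

End expected_shortfall.

Theorem lemma5p3 (R : realType) (d : measure_display) (T : measurableType d)
    (P : probability T R) (alpha : R) (alpha01 : 0 <= alpha < 1) :
  convex_cone (quantile_domain (P := P) (ES_probability alpha01)) /\
  risk_subadditive P (ES_probability alpha01).
Proof. by split; [exact: ES_convex_cone|exact: ES_subadditive]. Qed.
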